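(* Let $m\le 5$ be a natural number, let $x^6+ax^m+b\in\mathbb{Z}[x]$ be a monic irreducible trinomial, and let $K=\mathbb{Q}(\theta)$ be the sextic number field generated by a root $\theta$ of it. Then the following statements hold: (1) If $a\equiv 0\pmod 9$ and $b\equiv -1\pmod 9$, then $3$ divides $i(K)$. (2) If $a\equiv 0\pmod 8$ and $b\equiv -1\pmod 4$, then $2$ divides $i(K)$. In particular, if one of these conditions holds, then $K$ is not monogenic.
   Context: For a number field $K$ of degree $n$ with ring of integers $\mathbb{Z}_K$, the index of $K$ is $i(K)=\gcd\{(\mathbb{Z}_K:\mathbb{Z}[\alpha])\;:\;\alpha\in\mathbb{Z}_K,\ K=\mathbb{Q}(\alpha)\}$. The field $K$ is called monogenic if $\mathbb{Z}_K$ admits a $\mathbb{Z}$-basis of the form $(1,\alpha,\ldots,\alpha^{n-1})$ for some $\alpha\in\mathbb{Z}_K$. *)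

(* Defs.v *)
From HB Require Import structures.
From mathcomp Require Import all_boot all_order all_algebra all_field.
From mathcomp Require Import finmap.
From mathcomp Require Import boolp classical_sets functions cardinality.

Set Implicit Arguments.
Unset Strict Implicit.
Unset Printing Implicit Defensive.

Import GRing.Theory.

Local Open Scope classical_set_scope.
Local Open Scope ring_scope.

Definition is_gcd_of_set (S : set nat) (d : nat) : Prop :=
  (forall n, S n -> d %| n)%N /\
  (forall e, (forall n, S n -> e %| n) -> e %| d)%N.

(* A gcd always exists (gcd_setP), so the default value of xget plays no role. *)
Definition gcd_set (S : set nat) : nat := xget 0%N (is_gcd_of_set S).

Lemma gcd_setP (S : set nat) : is_gcd_of_set S (gcd_set S).
Proof.
rewrite /gcd_set; suff [d Sd] : exists d, is_gcd_of_set S d.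
  by case: xgetP => [d' -> //|/(_ d)].
have [[n0 [Sn0 n0_gt0]]|no_pos] := pselect (exists n, S n /\ (0 < n)%N); last first.
  exists 0%N; split=> [n Sn|e _]; last exact: dvdn0.
  by case: n Sn => // n Sn; case: no_pos; exists n.+1.
pose common (e : nat) := `[< forall n, S n -> (e %| n)%N >].
exists (\big[lcmn/1%N]_(e < n0.+1 | common e) (e : nat)); split=> [n Sn|e eS].
  by apply/dvdn_biglcmP => e /asboolP; apply.
have e_lt : (e < n0.+1)%N by rewrite ltnS dvdn_leq ?eS.
by apply: (biglcmn_sup (Ordinal e_lt)) => //; apply/asboolP.
Qed.

(* Meant for H a subgroup of the additive group G: the number of cosets of H
   in G, and 0 if there are infinitely many. *)
Definition zindex (V : zmodType) (G H : set V) : nat :=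
  #|` fset_set [set [set x + h | h in H] | x in G]|.

Definition is_zbasis (V : zmodType) (G : set V) (n : nat) (e : 'I_n -> V) : Prop :=
  (forall i, G (e i)) /\
  (forall x, G x -> exists! c : {ffun 'I_n -> int}, x = \sum_(i < n) e i *~ c i).

Section NumberField.
Variable K : fieldExtType rat.

Definition ring_of_integers : set K :=
  [set x | integralOver (intr : int -> K) x].

Definition Zadjoin (alpha : K) : set K :=
  [set (map_poly intr p).[alpha] | p in [set: {poly int}]].

Definition is_generator (alpha : K) : Prop := (<<1; alpha>> = {:K})%VS.

Definition field_index : nat :=
  gcd_set [set zindex ring_of_integers (Zadjoin alpha) |
            alpha in ring_of_integers `&` is_generator].

Definition monogenic : Prop :=
  exists2 alpha, ring_of_integers alpha &
    is_zbasis ring_of_integers (fun i : 'I_(\dim {:K}) => alpha ^+ i).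

End NumberField.

Definition trinomial6 (m : nat) (a b : int) : {poly int} :=
  'X^6 + a *: 'X^m + b%:P.

(* Main.v *)
Require Import Defs.
From HB Require Import structures.
From mathcomp Require Import all_boot all_order all_algebra all_field.
From mathcomp Require Import boolp classical_sets functions cardinality.
From mathcomp Require Import ring zify.

Set Implicit Arguments.
Unset Strict Implicit.
Unset Printing Implicit Defensive.

Import GRing.Theory.
Local Open Scope ring_scope.

(* An explicit order A = Z[theta, delta] of K is maximal at p, and has too many
   residue maps for Z[alpha] to have index prime to p.  For p = 3 take
   delta = (theta^2 - 1)^2 / 3: there are four ring maps A -> F_3, given by
   theta = 1, -1 and delta = 0, -1, so two of them agree at alpha.  For p = 2 take
   delta = (theta^3 - 1) / 2, a root of y^2 + y + (b + 1) / 4 + (a / 4) theta^m: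
   there are two maps A -> F_4 sending theta to the same primitive cube root of
   unity, and they agree at alpha up to Frobenius.  If p did not divide
   (Z_K : Z[alpha]), maps agreeing at alpha would be equal.  Maximality at p comes
   from the fact that if x in A and x / p is integral, then x is nilpotent modulo
   p A, hence killed by every map from A to a field of characteristic p. *)

(** * Subgroups, cosets and the index *)

Definition is_subgroup (V : zmodType) (H : set V) : Prop :=
  H 0 /\ forall x y, H x -> H y -> H (x - y).

Lemma subgroupD (V : zmodType) (H : set V) x y :
  is_subgroup H -> H x -> H y -> H (x + y).
Proof.
move=> [H0 HB] Hx Hy; rewrite -[y]opprK; apply: (HB _ _ Hx).
by rewrite -sub0r; apply: HB.
Qed.

Section Cosets.
Variables (V : zmodType) (G H : set V).
Hypotheses (sG : is_subgroup G) (sH : is_subgroup H).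

Let coset (x : V) : set V := [set x + h | h in H]%classic.

Let coset_in x y : coset x y -> H (y - x).
Proof. by move=> [h Hh <-]; rewrite addrC addKr. Qed.

Let coset_refl x : coset x x.
Proof. by exists 0; [apply: sH.1 | rewrite addr0]. Qed.

Let coset_eq x y : H (x - y) -> coset x = coset y.
Proof.
move=> Hxy; rewrite predeqE => z; split=> -[h Hh <-].
  by exists (x - y + h); [apply: subgroupD | rewrite addrA addrCA subrr addr0].
exists (h - (x - y)); first by apply: sH.2.
by rewrite opprB addrCA subrKC addrC.
Qed.

(* Translation by x permutes the cosets; comparing the sums of a set of
   representatives before and after gives the claim. *)
Lemma zindex_mul x : zindex G H != 0%N -> G x -> H (x *+ zindex G H).
Proof.
rewrite /zindex => nz Gx; set Q := [set coset y | y in G]%classic.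
(* An infinite quotient would turn [fset_set] into its default, the empty set, and the index into
   0. *)
have finQ : finite_set Q.
  apply: contrapT => infQ; move: nz; rewrite /fset_set.
  by case: pselect => // _; rewrite finmap.cardfs0.
rewrite -/Q; set s := finmap.enum_fset (fset_set Q).
have us : uniq s by apply: finmap.fset_uniq.
have inQ C : (C \in s) <-> Q C.
  by rewrite in_fset_set //; split=> [/set_mem|/mem_set].
(* A choice of representatives in [G]; by [rP], the default 0 is never taken on the coset of an
   element of [G]. *)
pose r (C : set V) := xget 0 (C `&` G)%classic.
have rP y : G y -> G (r (coset y)) /\ H (r (coset y) - y).
  move=> Gy; rewrite /r; case: xgetP => [z _ [yz Gz]|/(_ y)[]]; last by [].
  by split=> //; apply: coset_in.
pose tr C := coset (r C + x).
have trE y : G y -> tr (coset y) = coset (y + x).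
  by move=> /rP[Gr Hr]; apply: coset_eq; rewrite opprD addrACA subrr addr0.
have trs : {subset [seq tr C | C <- s] <= s}.
  move=> _ /mapP[_ /inQ[y Gy <-] ->]; apply/inQ; rewrite trE //.
  by exists (y + x) => //; apply: subgroupD.
have utr : uniq [seq tr C | C <- s].
  rewrite map_inj_in_uniq // => _ _ /inQ[y Gy <-] /inQ[z Gz <-].
  rewrite !trE // => yz; apply: coset_eq.
  have := coset_in (y := y + x) (x := z + x); rewrite -yz opprD addrACA subrr addr0.
  by apply; apply: coset_refl.
have ptr : perm_eq [seq tr C | C <- s] s.
  by apply: uniq_perm => //; have [] := uniq_min_size utr trs; rewrite ?size_map.
have Hsum : H (\sum_(C <- s) (r (tr C) - r C - x)).
  rewrite big_seq; apply: (big_ind H) => [|y z|_ /inQ[y Gy <-]]; first exact: sH.1.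
    exact: subgroupD.
  have [Gr Hr] := rP _ Gy; rewrite -addrA -opprD.
  have [] := rP (r (coset y) + x); first exact: subgroupD.
  by [].
move: Hsum; rewrite !big_split /= !sumrN.
(* Since [tr] permutes the cosets, the two sums of representatives cancel, and only [x] counted once
   per coset is left. *)
rewrite -(big_map tr xpredT r) (perm_big _ ptr) /= subrr add0r.
rewrite big_const_seq count_predT -Monoid.iteropE => /(sH.2 _ _ sH.1).
by rewrite sub0r opprK.
Qed.
End Cosets.

Lemma zindex_id (V : zmodType) (G : set V) : is_subgroup G -> zindex G G = 1%N.
Proof.
move=> sG; rewrite /zindex (_ : [set _ | _ in G]%classic = [set G]%classic).
  by rewrite fset_set1 finmap.cardfs1.
rewrite predeqE => C; split=> [[x Gx <-]|->] /=.
  rewrite predeqE => y; split=> [[h Gh <-]|Gy]; first exact: subgroupD.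
  by exists (y - x); [apply: sG.2 | rewrite addrC subrK].
exists 0; first exact: sG.1.
by rewrite predeqE => y; split=> [[h Gh <-]|Gy]; [|exists y]; rewrite ?add0r.
Qed.

(** * Closure properties of the ring of integers *)

Section Integers.
Variable K : fieldExtType rat.
Implicit Types x y alpha : K.

Lemma integerD x y :
  ring_of_integers x -> ring_of_integers y -> ring_of_integers (x + y).
Proof. exact: (@integral_add int K intr). Qed.

Lemma integerB x y :
  ring_of_integers x -> ring_of_integers y -> ring_of_integers (x - y).
Proof. exact: (@integral_sub int K intr). Qed.

Lemma integerM x y :
  ring_of_integers x -> ring_of_integers y -> ring_of_integers (x * y).
Proof. exact: (@integral_mul int K intr). Qed.

Lemma integer_int (z : int) : ring_of_integers (z%:~R : K).
Proof. exact: (@integral_id int K intr). Qed.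

Lemma integerX x n : ring_of_integers x -> ring_of_integers (x ^+ n).
Proof.
move=> Ox; elim: n => [|n IHn]; first exact: (integer_int 1).
by rewrite exprS; apply: integerM.
Qed.

Lemma integer_subgroup : is_subgroup (@ring_of_integers K).
Proof. by split; [apply: (integer_int 0) | apply: integerB]. Qed.

Lemma Zadjoin_subgroup alpha : is_subgroup (Zadjoin alpha).
Proof.
split; first by exists 0; rewrite // rmorph0 horner0.
by move=> _ _ [p _ <-] [q _ <-]; exists (p - q); rewrite // rmorphB hornerD hornerN.
Qed.
Lemma integer_root_monic (p : {poly K}) x : p \is monic -> root p x ->
  (forall i, ring_of_integers p`_i) -> ring_of_integers x.
Proof.
move=> mp px Op; apply: (integral_root_monic mp px) => c /(nthP 0)[i _ <-]; exact: Op.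
Qed.
End Integers.

Lemma natrK_eq0 (K : fieldExtType rat) n : (n%:R == 0 :> K) = (n == 0%N).
Proof.
rewrite (_ : n%:R = GRing.in_alg K n%:R); last by rewrite rmorph_nat.
by rewrite fmorph_eq0 Num.Theory.pnatr_eq0.
Qed.

(** * Residue maps, maximality at a prime and the index *)

Section Order.
Variables (B : comNzRingType) (K : fieldExtType rat) (ev : {rmorphism B -> K}).
Variable p : nat.
Hypothesis p_prime : prime p.

Let p0 : (p%:R : K) != 0.
Proof. by rewrite natrK_eq0 -lt0n prime_gt0. Qed.

(* A monic integral equation for [ev P / p], cleared of denominators, gives
   [psi P ^+ k = 0]. *)
Lemma residue_div_integer (F : fieldType) (psi : {rmorphism B -> F}) P :
  p \in [pchar F] -> (forall Q, ev Q = 0 -> psi Q = 0) ->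
  ring_of_integers (ev P / p%:R) -> psi P = 0.
Proof.
move=> pF ker_psi [q mq /rootP qx]; pose k := (size q).-1.
have sq : size q = k.+1 by rewrite prednK // lt0n size_poly_eq0 monic_neq0.
pose R := \sum_(i < k) (q`_i)%:~R * p%:R ^+ (k - i) * P ^+ i + P ^+ k.
have qk : q`_k = 1 by move/monicP: mq; rewrite lead_coefE.
have evR : ev R = 0.
  rewrite -[RHS](mulr0 (p%:R ^+ k)) -qx (@horner_coef_wide _ k.+1); last first.
    by rewrite -sq size_poly.
  rewrite rmorphD rmorph_sum big_ord_recr /= mulrDr mulr_sumr; congr (_ + _).
    apply: eq_bigr => i _; rewrite !rmorphM !rmorphXn rmorph_int rmorph_nat coef_map /=.
    have -> : p%:R ^+ k = p%:R ^+ (k - i) * p%:R ^+ i :> K.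
      by rewrite -exprD subnK // ltnW.
    rewrite expr_div_n -!mulrA mulrCA; congr (_ * _); rewrite mulrCA; congr (_ * _).
    by rewrite mulrCA mulfV ?mulr1 // expf_neq0.
  by rewrite coef_map qk /= rmorphXn mul1r expr_div_n mulrCA mulfV ?mulr1 // expf_neq0.
(* Each term with [i < k] carries a positive power of [p], which is 0 in [F]; only [psi P ^+ k]
   survives. *)
have := ker_psi _ evR; rewrite rmorphD rmorph_sum big1 => [|i _]; last first.
  rewrite !rmorphM !rmorphXn rmorph_nat (pcharf0 pF) expr0n.
  by rewrite subn_eq0 leqNgt ltn_ord mulr0 mul0r.
by rewrite add0r rmorphXn => /eqP; rewrite expf_eq0 => /andP[_ /eqP].
Qed.

(** Descent on the denominator [n]: if [p] divides [n], then [ev P / p] is an integer multiple of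
    [x], hence integral, and the first hypothesis strips one factor [p] from [n]. *)
Lemma maximal_at_prime :
  (forall P, ring_of_integers (ev P / p%:R) -> exists Q, ev P = p%:R * ev Q) ->
  (forall x : K, exists2 n, (0 < n)%N & exists P, ev P = n%:R * x) ->
  forall x : K, ring_of_integers x ->
    exists2 n, ~~ (p %| n)%N & exists P, ev P = n%:R * x.
Proof.
move=> sat clear x Ox; have [n] := clear x.
elim/ltn_ind: n => n IHn n0 [P evP].
have [/dvdnP[k nE]|] := boolP (p %| n)%N; last by exists n => //; exists P.
move: n0; rewrite nE muln_gt0 => /andP[k0 _].
apply: (IHn k) => //; first by rewrite nE ltn_Pmulr ?prime_gt1.
have evPp : ev P / p%:R = k%:R * x.
  by rewrite evP nE natrM mulrAC mulfK.
have [|Q evQ] := sat P.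
  by rewrite evPp; apply: integerM => //; apply: (integer_int _ k).
by exists Q; rewrite -evPp evQ mulrC mulKf.
Qed.

(** With [N] the index, [N * ev Q] is a polynomial [h] in [alpha]. Multiplied by a power of [n], it
    becomes an integer polynomial in [P], where both maps agree; [N] and [n] are then cancelled,
    being nonzero in [F]. *)
Lemma residues_agree (F : fieldType) (psi1 psi2 : {rmorphism B -> F}) alpha n P Q :
  p \in [pchar F] ->
  (forall R, ev R = 0 -> psi1 R = 0) -> (forall R, ev R = 0 -> psi2 R = 0) ->
  ~~ (p %| zindex (@ring_of_integers K) (Zadjoin alpha))%N ->
  ~~ (p %| n)%N -> ev P = n%:R * alpha -> psi1 P = psi2 P ->
  ring_of_integers (ev Q) -> psi1 Q = psi2 Q.
Proof.
set N := zindex _ _ => pF ker1 ker2 pN pn evP psiP OQ.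
have [|h _ hE] := zindex_mul (integer_subgroup K) (Zadjoin_subgroup alpha) _ OQ.
  by apply: contraNneq pN => N0; rewrite /N N0 dvdn0.
rewrite -/N in hE; pose k := size h.
(* The exponent [k = size h] exceeds the degree of [h], so [n ^+ k] clears the denominator of every
   power of [alpha = ev P / n] occurring in [h]. *)
pose R := N%:R * n%:R ^+ k * Q - \sum_(i < k) (h`_i)%:~R * n%:R ^+ (k - i) * P ^+ i.
have evR : ev R = 0.
  rewrite /R rmorphB !rmorphM rmorphXn !rmorph_nat [N%:R * _]mulrC -mulrA mulr_natl -hE.
  rewrite (@horner_coef_wide _ k) ?size_poly // mulr_sumr rmorph_sum -sumrB big1 // => i _.
  rewrite !rmorphM !rmorphXn rmorph_int rmorph_nat coef_map /= evP exprMn.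
  have -> : n%:R ^+ k = n%:R ^+ (k - i) * n%:R ^+ i :> K by rewrite -exprD subnK // ltnW.
  ring.
have eqR : psi1 (N%:R * n%:R ^+ k * Q) = psi2 (N%:R * n%:R ^+ k * Q).
  move: (ker1 _ evR) (ker2 _ evR); rewrite !rmorphB => /subr0_eq-> /subr0_eq->.
  rewrite !rmorph_sum; apply: eq_bigr => i _.
  by rewrite !rmorphM !rmorphXn !rmorph_int !rmorph_nat psiP.
move: eqR; rewrite !rmorphM !rmorphXn !rmorph_nat => /mulfI; apply.
by rewrite mulf_neq0 ?expf_neq0 // -(dvdn_pcharf pF).
Qed.
End Order.

(** * Evaluation of integer polynomials in two variables *)

(* The outer variable of [{poly {poly int}}] is evaluated at [y], the inner one
   at [x]. *)
Section BivariateEvaluation.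
Variables (T : comNzRingType) (x y : T).

Definition bieval : {poly {poly int}} -> T :=
  horner_eval y \o map_poly (horner_eval x \o map_poly intr).

HB.instance Definition _ := GRing.RMorphism.on bieval.

Lemma bievalC (q : {poly int}) : bieval q%:P = (map_poly intr q).[x].
Proof. by rewrite /bieval /= map_polyC /horner_eval hornerC. Qed.

Lemma bievalX : bieval 'X%:P = x.
Proof. by rewrite bievalC map_polyX hornerX. Qed.

Lemma bievalY : bieval 'X = y.
Proof. by rewrite /bieval /= map_polyX /horner_eval hornerX. Qed.
End BivariateEvaluation.

(** * Orders given by relations and a spanning family *)

Section Spanning.
Variable rel : forall T : comNzRingType, T -> T -> Prop.
Variables (n : nat) (E : nat -> {poly {poly int}}).

(** The coefficients [v] are chosen before the ring and the point, so the same coordinates serve in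
    [K] and in every residue field. *)
Definition spanned (P : {poly {poly int}}) : Prop :=
  exists v : nat -> int, forall (T : comNzRingType) (x y : T), rel x y ->
    bieval x y P = \sum_(0 <= i < n) (v i)%:~R * bieval x y (E i).

Lemma spanned_eq Q P : spanned Q ->
  (forall (T : comNzRingType) (x y : T), rel x y -> bieval x y P = bieval x y Q) ->
  spanned P.
Proof. by move=> [v vQ] PQ; exists v => T x y rxy; rewrite PQ // vQ. Qed.

Lemma spannedD P Q : spanned P -> spanned Q -> spanned (P + Q).
Proof.
move=> [v vP] [w wQ]; exists (fun i => v i + w i) => T x y rxy.
rewrite rmorphD /= vP // wQ // -big_split; apply: eq_bigr => i _.
by rewrite rmorphD mulrDl.
Qed.

Lemma spanned_int (c : int) P : spanned P -> spanned (c%:~R * P).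
Proof.
move=> [v vP]; exists (fun i => c * v i) => T x y rxy.
rewrite rmorphM rmorph_int /= vP // mulr_sumr; apply: eq_bigr => i _.
by rewrite rmorphM mulrA.
Qed.

Lemma spannedB P Q : spanned P -> spanned Q -> spanned (P - Q).
Proof.
move=> sP sQ; apply: (spanned_eq (spannedD sP (spanned_int (-1) sQ))) => T x y _.
by rewrite rmorphN1 mulN1r.
Qed.

Lemma spanned_basis i : (i < n)%N -> spanned (E i).
Proof.
move=> ltin; exists (fun j => (j == i)%:R) => T x y _.
rewrite big_mkord (bigD1 (Ordinal ltin)) //= eqxx mul1r big1 ?addr0 // => j.
by rewrite -val_eqE /= => /negPf->; rewrite mul0r.
Qed.

Lemma spanned_mul R P : (forall i, (i < n)%N -> spanned (R * E i)) ->
  spanned P -> spanned (R * P).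
Proof.
move=> sRE [v vP]; apply: (@spanned_eq (\sum_(0 <= i < n) (v i)%:~R * (R * E i))).
  rewrite big_nat; apply: (big_ind spanned) => [||i ltin].
  - by exists (fun=> 0) => T x y _; rewrite rmorph0 big1 // => i _; rewrite mul0r.
  - by move=> ? ?; apply: spannedD.
  - by apply: spanned_int; apply: sRE.
move=> T x y rxy; rewrite rmorphM /= vP // rmorph_sum mulr_sumr; apply: eq_bigr => i _.
by rewrite !rmorphM rmorph_int /= mulrCA.
Qed.

(** The span contains 1 and is stable under multiplication by both variables, so induction on the
    two levels of polynomials reaches everything. *)
Lemma spanned_all : spanned 1 ->
  (forall i, (i < n)%N -> spanned ('X%:P * E i)) ->
  (forall i, (i < n)%N -> spanned ('X * E i)) -> forall P, spanned P.
Proof.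
move=> s1 sX sY; elim/poly_ind => [|P c sP].
  by apply: (spanned_eq (spanned_int 0 s1)) => T x y _; rewrite mul0r.
apply: spannedD; first by rewrite mulrC; apply: spanned_mul.
elim/poly_ind: c => [|q c sq].
  by apply: (spanned_eq (spanned_int 0 s1)) => T x y _; rewrite mul0r.
rewrite rmorphD rmorphM /=; apply: spannedD; first by rewrite mulrC; apply: spanned_mul.
apply: (spanned_eq (spanned_int c s1)) => T x y _.
by rewrite mulr1 -[c in LHS]intz !rmorph_int.
Qed.

(** Makes residue maps well defined on the order: where the family is independent, a vanishing value
    forces all coordinates to be 0, and these coordinates compute the value at every other solution
    of [rel]. *)
Lemma bieval_ker (T0 : comNzRingType) (x0 y0 : T0) : rel x0 y0 ->
  (forall v : nat -> int, \sum_(0 <= i < n) (v i)%:~R * bieval x0 y0 (E i) = 0 ->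
     forall i, (i < n)%N -> v i = 0) ->
  forall P, spanned P -> bieval x0 y0 P = 0 ->
  forall (T : comNzRingType) (x y : T), rel x y -> bieval x y P = 0.
Proof.
move=> r0 indep P [v vP] P0 T x y rxy; rewrite vP // big_nat big1 // => i /andP[_ ltin].
by rewrite indep ?mul0r // -vP.
Qed.
End Spanning.

(** * Rational and integral relations between powers of the generator *)

Section Generator.
Variables (K : fieldExtType rat) (theta : K).

Lemma clear_denominators (delta : K) : is_generator theta ->
  forall x : K, exists2 n, (0 < n)%N & exists P, bieval theta delta P = n%:R * x.
Proof.
move=> gen x; have /Fadjoin_polyP[r /polyOver1P[r' ->] ->] : x \in <<1; theta>>%VS.
  by rewrite gen memvf.
have [q [a a0 ->]] := rat_poly_scale r'.
exists `|a|%N; first by rewrite absz_gt0.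
(* The sign of the common denominator [a] moves to the numerator, because [n] is its absolute
   value. *)
exists ((Num.sg a)%:~R * q%:P).
rewrite rmorphM rmorph_int /= bievalC linearZ /= hornerZ -map_poly_comp /=.
rewrite (eq_map_poly (g := intr)) => [|z /=]; last by rewrite scaler_int.
rewrite -[_%:A]/(GRing.in_alg K _) fmorphV rmorph_int mulrA; congr (_ * _).
have aK : (a%:~R : K) != 0.
  by rewrite -(rmorph_int (GRing.in_alg K)) fmorph_eq0 intr_eq0.
apply: (mulIf aK); rewrite mulfVK // -intrM -Num.Theory.normrEsg.
by rewrite -[RHS]/((Posz `|a|)%:~R) -abszE.
Qed.

(** A nonzero [Poly c] would be coprime to the irreducible [f], being of smaller size, and could not
    share the root [theta] with it. *)
Lemma small_degree_independent (f : {poly int}) (c : seq int) :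
  irreducible_poly (map_poly (intr : int -> rat) f) ->
  root (map_poly (intr : int -> K) f) theta -> (size c < size f)%N ->
  \sum_(0 <= i < size c) (c`_i)%:~R * theta ^+ i = 0 -> forall i, c`_i = 0.
Proof.
move=> [_ irr] rf ltcf c0 i.
have mapK (q : {poly int}) :
    map_poly (GRing.in_alg K) (map_poly (intr : int -> rat) q) = map_poly intr q.
  by rewrite -map_poly_comp; apply: eq_map_poly => z /=; rewrite scaler_int.
have szQ (q : {poly int}) : size (map_poly (intr : int -> rat) q) = size q.
  by apply: size_map_inj_poly; [apply: intr_inj | ].
have root_c : (map_poly intr (Poly c)).[theta] = 0.
  rewrite (@horner_coef_wide _ (size c)).
    by rewrite -[RHS]c0 big_mkord; apply: eq_bigr => j _; rewrite coef_map coef_Poly.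
  by apply: leq_trans (size_Poly c); apply: size_poly.
suff : Poly c = 0 by move/(congr1 (fun q : {poly int} => q`_i)); rewrite coef_Poly coef0.
apply/eqP; apply: contraT => cn0.
set F := map_poly (intr : int -> rat) f in irr *.
set G := map_poly (intr : int -> rat) (Poly c).
have G0 : G != 0 by rewrite -size_poly_eq0 szQ size_poly_eq0.
have cop : coprimep F G.
  apply: contraT => /irr/(_ (dvdp_gcdl _ _))/eqp_dvdr dvF.
  have := dvdp_leq G0 (dvdp_trans _ (dvdp_gcdr F G)) .
  move=> /(_ F); rewrite dvF dvdpp => /(_ isT); rewrite !szQ leqNgt.
  by rewrite (leq_ltn_trans (size_Poly c) ltcf).
move: cop; rewrite -(coprimep_map (GRing.in_alg K)) !mapK => /coprimep_root/(_ rf).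
by rewrite root_c eqxx.
Qed.
End Generator.

(** * Integrality criteria and basic facts on the trinomial *)

Section IntegralElements.
Variable K : fieldExtType rat.
Implicit Types x y s t : K.

Lemma integer_quadratic y s t : ring_of_integers s -> ring_of_integers t ->
  y ^+ 2 = s * y + t -> ring_of_integers y.
Proof.
move=> Os Ot yE; pose r : {poly K} := - (s *: 'X + t%:P).
have sr : (size r < size ('X^2 : {poly K}))%N.
  rewrite size_polyXn size_polyN ltnS (leq_trans (size_polyD _ _)) // geq_max.
  rewrite (leq_trans (size_scale_leq _ _)) ?size_polyX //.
  by rewrite (leq_trans (size_polyC_leq1 _)).
apply: (@integer_root_monic _ ('X^2 + r)).
- by rewrite monicE lead_coefDl // lead_coefXn.
- by rewrite /root !hornerE yE subrr.
move=> i; rewrite !coefE; apply: integerD; first exact: (integer_int _ (i == 2)).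
rewrite -sub0r; apply: integerB; first exact: (integer_int _ 0).
apply: integerD; first by apply: integerM => //; apply: (integer_int _ (i == 1)).
by case: eqP => // _; apply: (integer_int _ 0).
Qed.

Lemma integer_bieval x y P :
  ring_of_integers x -> ring_of_integers y -> ring_of_integers (bieval x y P).
Proof.
move=> Ox Oy; elim/poly_ind: P => [|P q OP].
  by rewrite rmorph0; apply: (integer_int _ 0).
rewrite rmorphD rmorphM /= bievalY bievalC; apply: integerD; first exact: integerM.
elim/poly_ind: q => [|q z Oq]; first by rewrite rmorph0 horner0; apply: (integer_int _ 0).
rewrite rmorphD rmorphM /= map_polyX map_polyC hornerD hornerMX hornerC.
by apply: integerD; [apply: integerM | apply: integer_int].
Qed.

Lemma size_trinomial6_tail (m : nat) (a b : int) : (m <= 5)%N ->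
  (size (a *: 'X^m + b%:P)%R < size ('X^6 : {poly int}))%N.
Proof.
move=> m5; rewrite size_polyXn ltnS (leq_trans (size_polyD _ _)) // geq_max.
rewrite (leq_trans (size_scale_leq _ _)) ?size_polyXn //.
by rewrite (leq_trans (size_polyC_leq1 _)).
Qed.

Lemma size_trinomial6 m a b : (m <= 5)%N -> size (trinomial6 m a b) = 7%N.
Proof.
by move=> m5; rewrite /trinomial6 -addrA size_polyDl ?size_trinomial6_tail ?size_polyXn.
Qed.

Lemma trinomial6_monic m a b : (m <= 5)%N -> trinomial6 m a b \is monic.
Proof.
move=> m5; rewrite /trinomial6 -addrA monicE lead_coefDl ?size_trinomial6_tail //.
by rewrite lead_coefXn.
Qed.

Lemma trinomial6_root m a b x :
  root (map_poly intr (trinomial6 m a b)) x -> x ^+ 6 + a%:~R * x ^+ m + b%:~R = 0.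
Proof.
move/rootP; rewrite /trinomial6 !rmorphD /= map_polyZ !map_polyXn map_polyC /=.
by rewrite !hornerE.
Qed.
End IntegralElements.

(** * The order at 2: generators, relations and reduction to six elements *)

Section OrderAtTwo.
Variables (m : nat) (a c : int).
Hypothesis m_le5 : (m <= 5)%N.

(* Satisfied by [x = theta] and [y = (theta ^+ 3 - 1) / 2] when [theta] is a root
   of [X^6 + 8 a X^m + 4 c - 1]. *)
Definition order2_rel (T : comNzRingType) (x y : T) : Prop :=
  x ^+ 3 = 1 + 2 * y /\ y ^+ 2 = - y - c%:~R - 2 * a%:~R * x ^+ m.

Definition order2_basis (i : nat) : {poly {poly int}} :=
  [:: 1; 'X%:P; 'X%:P ^+ 2; 'X; 'X%:P * 'X; 'X%:P ^+ 2 * 'X]`_i.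

Let sp := spanned order2_rel 6 order2_basis.

Let bE := (rmorphM, rmorphD, rmorphB, rmorphN, rmorphXn, rmorph1, rmorph_int).

Lemma order2_spanned P : sp P.
Proof.
have sE i : (i < 6)%N -> sp (order2_basis i) by apply: spanned_basis.
have s0 := sE 0 isT; have s1 := sE 1 isT; have s2 := sE 2 isT.
have s3 := sE 3 isT; have s4 := sE 4 isT; have s5 := sE 5 isT.
rewrite /order2_basis /= in s0 s1 s2 s3 s4 s5.
have sX3 : sp ('X%:P ^+ 3).
  apply: (spanned_eq (spannedD s0 (spanned_int 2 s3))) => T x y [h1 h2].
  rewrite ?bE /= ?bievalX ?bievalY; ring: h1.
(* The second relation contains [x ^+ m], so this power is reduced first; for [m] equal to 4 or 5
   one use of [x ^+ 3 = 1 + 2 * y] suffices. *)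
have sXm : sp ('X%:P ^+ m).
  case: (m) m_le5 => [|[|[|[|[|[|//]]]]]] _ //.
  - apply: (spanned_eq (spannedD s1 (spanned_int 2 s4))) => T x y [h1 h2].
    rewrite ?bE /= ?bievalX ?bievalY; ring: h1.
  - apply: (spanned_eq (spannedD s2 (spanned_int 2 s5))) => T x y [h1 h2].
    rewrite ?bE /= ?bievalX ?bievalY; ring: h1.
have sYY : sp ('X * 'X).
  apply: (spanned_eq (spannedB (spannedB (spanned_int (-1) s3) (spanned_int c s0))
    (spanned_int (2 * a) sXm))) => T x y [h1 h2].
  rewrite ?bE /= ?bievalX ?bievalY; ring: h2.
have sX i : (i < 6)%N -> sp ('X%:P * order2_basis i).
  case: i => [|[|[|[|[|[|//]]]]]] _; rewrite /order2_basis /=.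
  - by rewrite mulr1.
  - by rewrite -expr2.
  - by rewrite -exprS.
  - by [].
  - by rewrite mulrA -expr2.
  - apply: (spanned_eq (spannedD s3 (spanned_int 2 sYY))) => T x y [h1 h2].
    rewrite ?bE /= ?bievalX ?bievalY; ring: h1.
apply: spanned_all => // i; rewrite -/sp.
case: i => [|[|[|[|[|[|//]]]]]] _; rewrite /order2_basis /=.
- by rewrite mulr1.
- by rewrite mulrC.
- by rewrite mulrC.
- by [].
- by rewrite mulrCA; apply: spanned_mul.
- by rewrite mulrCA expr2 -mulrA; do 2!apply: spanned_mul => //.
Qed.
End OrderAtTwo.

Lemma spanned_divisible n E (K : fieldExtType rat) (x y : K) (p : nat) (v : nat -> int) :
  (forall i, (i < n)%N -> (p %| v i)%Z) ->
  exists Q, \sum_(0 <= i < n) (v i)%:~R * bieval x y (E i) = p%:R * bieval x y Q.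
Proof.
move=> pv; exists (\sum_(0 <= i < n) (v i %/ p)%Z%:~R * E i).
rewrite rmorph_sum mulr_sumr !big_mkord; apply: eq_bigr => i _.
rewrite rmorphM rmorph_int mulrA; congr (_ * _).
by rewrite -{1}(divzK (pv _ (ltn_ord i))) intrM mulrC.
Qed.

(** * Residue fields of characteristic 2 *)

Lemma four_element_field : exists (F : finFieldType) (w : F),
  [/\ 2%N \in [pchar F], w ^+ 2 + w + 1 = 0 & forall x : F, x ^+ 4 = x].
Proof.
have [F charF cardF] := @pPrimePowerField 2 2 isT isT.
have x4 (x : F) : x ^+ 4 = x by have := expf_card x; rewrite cardF.
suff [w /andP[w0 w1]] : exists w : F, (w != 0) && (w != 1).
  (* The factors [w] and [w - 1] of [w ^+ 4 - w] are nonzero and can be cancelled. *)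
  exists F, w; split=> //; apply: (mulfI w0); apply: (mulfI (x := w - 1)).
    by rewrite subr_eq0.
  rewrite !mulr0; transitivity (w ^+ 4 - w); first by ring.
  by rewrite x4 subrr.
apply/existsP; apply: contraTT isT => /existsPn w01.
have sub : F \subset pred2 0 1.
  by apply/fintype.subsetP => x _; have := w01 x; rewrite negb_and !negbK inE.
by have := subset_leq_card sub; rewrite cardF card2 eq_sym oner_eq0.
Qed.

(** Only the parity of [c] matters: 0 is a root for [c] even, [w] for [c] odd. *)
Lemma artin_schreier_root (F : fieldType) (w : F) (c : int) :
  2 = 0 :> F -> w ^+ 2 + w + 1 = 0 -> exists d : F, d ^+ 2 + d + c%:~R = 0.
Proof.
move=> F2 w2; have F2' : 2%:~R = 0 :> F := F2.
have [k [->|->]] : exists k, c = 2 * k \/ c = 2 * k + 1.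
- by exists (c %/ 2)%Z; lia.
- by exists 0; rewrite rmorphM /= F2' mul0r expr0n !addr0.
- by exists w; rewrite rmorphD rmorphM /= F2' mul0r add0r.
Qed.

Lemma vandermonde_cube_roots (F : fieldType) (w A0 A1 A2 : F) :
  2 = 0 :> F -> w ^+ 2 + w + 1 = 0 ->
  (forall t : F, t ^+ 3 = 1 -> A0 + A1 * t + A2 * t ^+ 2 = 0) ->
  A0 = 0 /\ A1 = 0 /\ A2 = 0.
Proof.
move=> F2 w2 At.
have w3 : w ^+ 3 = 1.
  apply/eqP; rewrite -subr_eq0; apply/eqP.
  by transitivity ((w - 1) * (w ^+ 2 + w + 1)); [ring|rewrite w2 mulr0].
have q1 := At 1 (expr1n _ _); have q2 := At w w3.
have q3 : A0 + A1 * w ^+ 2 + A2 * (w ^+ 2) ^+ 2 = 0.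
  by apply: At; rewrite exprAC w3 expr1n.
set p1 := _ + _ in q1; set p2 := _ + _ in q2; set p3 := _ + _ in q3.
set s := _ + _ in w2.
(* Inverse Fourier transform on the cube roots of unity: weighting the value at [t] by [t ^- i] and
   summing gives three times the [i]-th coefficient up to multiples of [s], and 3 = 1 in
   characteristic 2. *)
split; [|split].
- transitivity (p1 + p2 + p3 - s * (A1 + A2 * (1 - w + w ^+ 2)) - 2 * A0).
    by rewrite /p1 /p2 /p3 /s; ring.
  by rewrite q1 q2 q3 w2 F2; ring.
- transitivity (p1 + w ^+ 2 * p2 + w * p3 - s * (A0 + A1 * 2 * (w - 1) +
    A2 * (1 + (w + w ^+ 2) * (w - 1))) - 2 * A1).
    by rewrite /p1 /p2 /p3 /s; ring.
  by rewrite q1 q2 q3 w2 F2; ring.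
- transitivity (p1 + w * p2 + w ^+ 2 * p3 - s * (A0 + A1 * (1 - w + w ^+ 2) +
    A2 * (w - 1) * (w ^+ 3 + 2)) - 2 * A2).
    by rewrite /p1 /p2 /p3 /s; ring.
  by rewrite q1 q2 q3 w2 F2; ring.
Qed.

(** Modulo 2 the two relations decouple, so [t] and [d] can be chosen independently. *)
Lemma order2_rel_char2 (T : comNzRingType) m a c (t d : T) :
  2 = 0 :> T -> t ^+ 3 = 1 -> d ^+ 2 + d + c%:~R = 0 -> order2_rel m a c t d.
Proof.
move=> T2 t3 dE; split; first by rewrite t3 T2 mul0r addr0.
rewrite T2 !mul0r subr0; apply/eqP; rewrite -subr_eq0; apply/eqP.
by rewrite -dE; ring.
Qed.

(** * Divisibility of the index by 2 *)

Section IndexAtTwo.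
Variables (K : fieldExtType rat) (theta : K) (m : nat) (a c : int).
Hypothesis m_le5 : (m <= 5)%N.
Let f := trinomial6 m (8 * a) (4 * c - 1).
Hypothesis f_irr : irreducible_poly (map_poly (intr : int -> rat) f).
Hypothesis f_root : root (map_poly (intr : int -> K) f) theta.
Hypothesis gen : is_generator theta.

Let two0 : (2 : K) != 0.
Proof. by rewrite natrK_eq0. Qed.

Let delta := (theta ^+ 3 - 1) / 2.

Let delta2 : 2 * delta = theta ^+ 3 - 1.
Proof. by rewrite mulrC mulfVK. Qed.

Let theta6 : theta ^+ 6 = - (8 * a%:~R * theta ^+ m) - (4 * c%:~R - 1).
Proof.
have /eqP := trinomial6_root f_root; rewrite -addrA addr_eq0 => /eqP->.
rewrite rmorphB !rmorphM /=; ring.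
Qed.

Let rel_delta : order2_rel m a c theta delta.
Proof.
split; first by rewrite delta2; ring.
(* After multiplication by 4 the claim concerns [2 * delta = theta ^+ 3 - 1], whose square is
   reduced by [theta6]. *)
apply: (mulfI two0); apply: (mulfI two0).
transitivity ((2 * delta) ^+ 2); first by ring.
transitivity (- 2 * (2 * delta) - 4 * c%:~R - 8 * a%:~R * theta ^+ m); last by ring.
by rewrite delta2; ring: theta6.
Qed.

Let indep (v : nat -> int) :
  \sum_(0 <= i < 6) (v i)%:~R * bieval theta delta (order2_basis i) = 0 ->
  forall i, (i < 6)%N -> v i = 0.
Proof.
rewrite /index_iota /= !big_cons big_nil /order2_basis /= !(rmorphM, rmorphXn, rmorph1) /=.
rewrite ?bievalX ?bievalY.
move=> v0.
(* The coefficients of 1, [theta], ..., [theta ^+ 5] in twice the given relation. *)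
pose s : seq int := [:: 2 * v 0%N - v 3%N; 2 * v 1%N - v 4%N; 2 * v 2%N - v 5%N;
  v 3%N; v 4%N; v 5%N].
have s0 : forall i, s`_i = 0.
  apply: (small_degree_independent f_irr f_root); first by rewrite size_trinomial6.
  rewrite /index_iota /= !big_cons big_nil /=.
  rewrite !(rmorphB, rmorphM) /= -[RHS](mulr0 2) -[X in _ = 2 * X]v0.
  by rewrite /delta; field.
have v3 := s0 3; have v4 := s0 4; have v5 := s0 5.
have := (s0 0, s0 1, s0 2); rewrite /= in v3 v4 v5 *; rewrite v3 v4 v5 => -[[v0' v1'] v2'].
by case=> [|[|[|[|[|[|//]]]]]] _ //; lia.
Qed.

Let ev := bieval theta delta.

(** If [ev P / 2] is integral, all residue maps kill [P]. Letting [theta] go to the three cube roots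
    of unity and [delta] to the two roots [d0] and [d0 + 1] isolates each of the six coordinates of
    [P] modulo 2. *)
Let maximal_at_2 (x : K) : ring_of_integers x ->
  exists2 n, ~~ (2 %| n)%N & exists P, ev P = n%:R * x.
Proof.
apply: maximal_at_prime => // [P OP|]; last exact: clear_denominators.
have [F [w [charF w2 x4]]] := four_element_field.
have [d0 d0E] := artin_schreier_root c (pcharf0 charF) w2.
have [v vP] := order2_spanned a c m_le5 P.
have relF := order2_rel_char2 m a (c := c) (pcharf0 charF).
have psi0 (t d : F) : t ^+ 3 = 1 -> d ^+ 2 + d + c%:~R = 0 ->
    ((v 0%N)%:~R + (v 3%N)%:~R * d) + ((v 1%N)%:~R + (v 4%N)%:~R * d) * t +
    ((v 2%N)%:~R + (v 5%N)%:~R * d) * t ^+ 2 = 0.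
  move=> t3 dE; transitivity (bieval t d P).
    rewrite vP; last exact: relF.
    rewrite /index_iota /= !big_cons big_nil /order2_basis /= !(rmorphM, rmorphXn, rmorph1) /=.
rewrite ?bievalX ?bievalY.
    by ring.
  apply: (residue_div_integer _ charF) OP => // Q Q0.
  by apply: (bieval_ker rel_delta indep (order2_spanned a c m_le5 Q) Q0); apply: relF.
have psi00 := vandermonde_cube_roots (pcharf0 charF) w2 (fun t t3 => psi0 t d0 t3 d0E).
have d1E : (d0 + 1) ^+ 2 + (d0 + 1) + c%:~R = 0.
  transitivity (d0 ^+ 2 + d0 + c%:~R + 2 * (d0 + 1)); first by ring.
  by rewrite d0E (pcharf0 charF) mul0r addr0.
have psi01 := vandermonde_cube_roots (pcharf0 charF) w2 (fun t t3 => psi0 t _ t3 d1E).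
have split (x0 y0 : F) : x0 + y0 * d0 = 0 -> x0 + y0 * (d0 + 1) = 0 -> x0 = 0 /\ y0 = 0.
  move=> e0 e1; have y00 : y0 = 0.
    transitivity ((x0 + y0 * (d0 + 1)) - (x0 + y0 * d0)); first by ring.
    by rewrite e0 e1 subrr.
  by move: e0; rewrite y00 mul0r addr0.
have even z : (z%:~R : F) = 0 -> (2 %| z)%Z by move/eqP; rewrite -(dvdz_pcharf charF).
move: psi00 psi01 => [p0 [p1 p2]] [p3 [p4 p5]].
have [v0 v3] := split _ _ p0 p3; have [v1 v4] := split _ _ p1 p4.
have [v2 v5] := split _ _ p2 p5.
have [|Q QE] := @spanned_divisible 6 order2_basis K theta delta 2 v.
  by case=> [|[|[|[|[|[|//]]]]]] _; apply: even.
by exists Q; rewrite -QE; apply: vP; apply: rel_delta.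
Qed.

Lemma two_dvd_zindex alpha : ring_of_integers alpha ->
  (2 %| zindex (@ring_of_integers K) (Zadjoin alpha))%N.
Proof.
move=> Oalpha; apply: contraT => odd_index.
have [F [w [charF w2 x4]]] := four_element_field.
have [d0 d0E] := artin_schreier_root c (pcharf0 charF) w2.
have F2 := pcharf0 charF.
have relF := order2_rel_char2 m a (c := c) F2.
have [n n_odd [P evP]] := maximal_at_2 Oalpha.
have Otheta : ring_of_integers theta.
  exists (trinomial6 m (8 * a) (4 * c - 1)) => //; exact: trinomial6_monic.
have Odelta : ring_of_integers delta.
  apply: (integer_quadratic (s := -1) (t := - c%:~R - 2 * a%:~R * theta ^+ m)).
  - exact: (integer_int _ (-1)).
  - rewrite (_ : _ - _ = (- c)%:~R - (2 * a)%:~R * theta ^+ m); last first.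
      by rewrite rmorphN rmorphM.
    by apply: integerB; [|apply: integerM; [|apply: integerX]] => //; apply: integer_int.
  - by rewrite rel_delta.2; ring.
have w3 : w ^+ 3 = 1.
  apply/eqP; rewrite -subr_eq0; apply/eqP.
  by transitivity ((w - 1) * (w ^+ 2 + w + 1)); [ring|rewrite w2 mulr0].
pose psi (d : F) : {rmorphism _ -> F} := bieval w d.
have ker_psi d : d ^+ 2 + d + c%:~R = 0 -> forall R, ev R = 0 -> psi d R = 0.
  move=> dE R R0.
  by apply: (bieval_ker rel_delta indep (order2_spanned a c m_le5 R) R0); apply: relF.
(* Composition with Frobenius sends [theta] to [w ^+ 2] instead of [w], so these maps differ from
   every [psi d] already at [theta]. *)
pose Fr : {rmorphism F -> F} := pFrobenius_aut charF.
pose psiF d : {rmorphism _ -> F} := Fr \o psi d.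
have ker_psiF d : d ^+ 2 + d + c%:~R = 0 -> forall R, ev R = 0 -> psiF d R = 0.
  by move=> dE R R0; rewrite /= ker_psi // rmorph0.
have d1E : (d0 + 1) ^+ 2 + (d0 + 1) + c%:~R = 0.
  transitivity (d0 ^+ 2 + d0 + c%:~R + 2 * (d0 + 1)); first by ring.
  by rewrite d0E F2 mul0r addr0.
have w_w2 : w <> w ^+ 2.
  move=> e; have /eqP := w2; rewrite -e -mulr2n -mulr_natl F2 mul0r add0r.
  exact/negP/oner_neq0.
have agree (psi1 psi2 : {rmorphism {poly {poly int}} -> F}) :=
  @residues_agree _ K ev 2 F psi1 psi2 alpha n P.
have psi_neqF d d' : d ^+ 2 + d + c%:~R = 0 -> d' ^+ 2 + d' + c%:~R = 0 ->
    psi d P <> (psi d' P) ^+ 2.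
  move=> dE dE' e; apply: w_w2.
  have := agree (psi d) (psiF d') 'X%:P charF
    (ker_psi _ dE) (ker_psiF _ dE') odd_index n_odd evP.
  by rewrite /= !pFrobenius_autE !bievalX; apply.
(* The maps for [d0] and [d0 + 1] differ at [delta], hence also at [P]. *)
have psi_neq : psi d0 P <> psi (d0 + 1) P.
  move=> e.
  have := agree (psi d0) (psi (d0 + 1)) 'X charF
    (ker_psi _ d0E) (ker_psi _ d1E) odd_index n_odd evP e.
  rewrite /= !bievalY => /(_ Odelta)/eqP.
  by rewrite -subr_eq0 opprD addrA subrr sub0r oppr_eq0 oner_eq0.
set u0 := psi d0 P in psi_neq; set u1 := psi (d0 + 1) P in psi_neq.
(* An element of the four-element field not fixed by Frobenius is a primitive cube root of unity;
   [psi_neqF] with [d = d'] applies this to [u0] and [u1]. *)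
have root_u (u : F) : u <> u ^+ 2 -> u ^+ 2 + u + 1 = 0.
  move=> uu; apply/eqP; have /eqP : u * (u - 1) * (u ^+ 2 + u + 1) = 0.
    by transitivity (u ^+ 4 - u); [ring|rewrite x4 subrr].
  rewrite !mulf_eq0 subr_eq0 => /orP[/orP[]/eqP uE|//]; case: uu; rewrite uE.
    by rewrite expr0n.
  by rewrite expr1n.
have u0E := root_u _ (psi_neqF _ _ d0E d0E); have u1E := root_u _ (psi_neqF _ _ d1E d1E).
case: (psi_neqF _ _ d0E d1E); rewrite -/u0 -/u1.
(* Two distinct roots of [X^2 + X + 1] have sum -1 and are squares of each other, which [psi_neqF]
   forbids. *)
have /eqP : (u0 - u1) * (u0 + u1 + 1) = 0.
  transitivity (u0 ^+ 2 + u0 + 1 - (u1 ^+ 2 + u1 + 1)); first by ring.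
  by rewrite u0E u1E subrr.
rewrite mulf_eq0 subr_eq0 => /orP[/eqP//|/eqP u01].
have -> : u0 = u0 + u1 + 1 + (u1 ^+ 2 - (u1 ^+ 2 + u1 + 1)) + 2 * 0 by ring.
by rewrite u01 u1E; ring.
Qed.
End IndexAtTwo.

(** * The order at 3: generators, relations and reduction to six elements *)

Section OrderAtThree.
Variables (m : nat) (a c : int).
Hypothesis m_le5 : (m <= 5)%N.

(* Satisfied by [x = theta] and [y = (theta ^+ 2 - 1) ^+ 2 / 3] when [theta] is a
   root of [X^6 + 9 a X^m + 9 c - 1]. *)
Definition order3_rel (T : comNzRingType) (x y : T) : Prop :=
  let u := x ^+ 2 - 1 in
  [/\ u ^+ 2 = 3 * y,
      u * y = - (3 * y) - u - 3 * c%:~R - 3 * a%:~R * x ^+ m &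
      y ^+ 2 = - (u * y) - y - c%:~R * u - a%:~R * (u * x ^+ m)].

(** The elements [u] and [x * u] replace [x ^+ 2] and [x ^+ 3] because [u ^+ 2 = 3 * y] makes them
    nilpotent modulo 3. *)
Definition order3_basis (i : nat) : {poly {poly int}} :=
  let u := 'X%:P ^+ 2 - 1 in [:: 1; 'X%:P; u; 'X%:P * u; 'X; 'X%:P * 'X]`_i.

Let sp := spanned order3_rel 6 order3_basis.

Let bE := (rmorphM, rmorphD, rmorphB, rmorphN, rmorphXn, rmorph1, rmorph_int).

Lemma order3_spanned P : sp P.
Proof.
have sE i : (i < 6)%N -> sp (order3_basis i) by apply: spanned_basis.
have s0 := sE 0%N isT; have s1 := sE 1%N isT; have s2 := sE 2%N isT.
have s3 := sE 3%N isT; have s4 := sE 4%N isT; have s5 := sE 5%N isT.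
rewrite /order3_basis /= in s0 s1 s2 s3 s4 s5.
(* Powers of [x] are expanded through [x ^+ 2 = 1 + u] and [u ^+ 2 = 3 * y]; then [u * y] and
   finally [y ^+ 2] can be reduced. *)
have sXm : sp ('X%:P ^+ m).
  case: (m) m_le5 => [|[|[|[|[|[|//]]]]]] _ //.
  - apply: (spanned_eq (spannedD s2 s0)) => T x y _.
    by rewrite ?bE /= ?bievalX; ring.
  - apply: (spanned_eq (spannedD s3 s1)) => T x y _.
    by rewrite ?bE /= ?bievalX; ring.
  - apply: (spanned_eq (spannedD (spannedD s0 (spanned_int 2 s2)) (spanned_int 3 s4))).
    move=> T x y [h _ _]; rewrite ?bE /= ?bievalX ?bievalY.
    by transitivity (1 + 2 * (x ^+ 2 - 1) + (x ^+ 2 - 1) ^+ 2); [ring|rewrite h; ring].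
  - apply: (spanned_eq (spannedD (spannedD s1 (spanned_int 2 s3)) (spanned_int 3 s5))).
    move=> T x y [h _ _]; rewrite ?bE /= ?bievalX ?bievalY.
    by transitivity (x * (1 + 2 * (x ^+ 2 - 1) + (x ^+ 2 - 1) ^+ 2)); [ring|rewrite h; ring].
have sUY : sp (('X%:P ^+ 2 - 1) * 'X).
  apply: (spanned_eq (spannedB (spannedB (spannedB (spanned_int (-3) s4) s2)
    (spanned_int (3 * c) s0)) (spanned_int (3 * a) sXm))) => T x y [_ h _].
  by rewrite ?bE /= ?bievalX ?bievalY -expr2 h; ring.
have sX i : (i < 6)%N -> sp ('X%:P * order3_basis i).
  case: i => [|[|[|[|[|[|//]]]]]] _; rewrite /order3_basis /=.
  - by rewrite mulr1.
  - apply: (spanned_eq (spannedD s2 s0)) => T x y _.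
    by rewrite ?bE /= ?bievalX; ring.
  - by [].
  - apply: (spanned_eq (spannedD s2 (spanned_int 3 s4))) => T x y [h _ _].
    rewrite ?bE /= ?bievalX ?bievalY.
    by transitivity (x ^+ 2 - 1 + (x ^+ 2 - 1) ^+ 2); [ring|rewrite h; ring].
  - by [].
  - apply: (spanned_eq (spannedD s4 sUY)) => T x y _.
    by rewrite ?bE /= ?bievalX ?bievalY; ring.
have spX P' : sp P' -> sp ('X%:P * P') by apply: spanned_mul.
have sYY : sp ('X * 'X).
  have sUXm : sp (('X%:P ^+ 2 - 1) * 'X%:P ^+ m).
    by rewrite mulrBl mul1r expr2 -mulrA; apply: spannedB => //; exact: spX (spX _ _).
  apply: (spanned_eq (spannedB (spannedB (spannedB (spanned_int (-1) sUY) s4)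
    (spanned_int c s2)) (spanned_int a sUXm))) => T x y [_ _ h].
  by rewrite ?bE /= ?bievalX ?bievalY -!expr2 h; ring.
apply: spanned_all => // i; rewrite -/sp.
case: i => [|[|[|[|[|[|//]]]]]] _; rewrite /order3_basis /=.
- by rewrite mulr1.
- by rewrite mulrC.
- by rewrite mulrC.
- by rewrite mulrCA [X in sp (_ * X)]mulrC; apply: spX.
- by [].
- by rewrite mulrCA; apply: spX.
Qed.
End OrderAtThree.

(** With [t ^+ 2 = 1] the element [u] becomes 0, and only the equation in [d] remains of the
    relations modulo 3. *)
Lemma order3_rel_char3 (T : comNzRingType) m a c (t d : T) :
  3 = 0 :> T -> t ^+ 2 = 1 -> d ^+ 2 + d = 0 -> order3_rel m a c t d.
Proof.
move=> T3 t2 dE; rewrite /order3_rel t2 subrr T3; split; try by ring.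
by rewrite -[LHS](addrK d) dE; ring.
Qed.

(** * Divisibility of the index by 3 *)

Section IndexAtThree.
Variables (K : fieldExtType rat) (theta : K) (m : nat) (a c : int).
Hypothesis m_le5 : (m <= 5)%N.
Let f := trinomial6 m (9 * a) (9 * c - 1).
Hypothesis f_irr : irreducible_poly (map_poly (intr : int -> rat) f).
Hypothesis f_root : root (map_poly (intr : int -> K) f) theta.
Hypothesis gen : is_generator theta.

Let Otheta : ring_of_integers theta.
Proof. by exists f => //; apply: trinomial6_monic. Qed.

Let three0 : (3 : K) != 0.
Proof. by rewrite natrK_eq0. Qed.

Let u := theta ^+ 2 - 1.
Let delta := u ^+ 2 / 3.

Let delta3 : u ^+ 2 = 3 * delta.
Proof. by rewrite mulrC mulfVK. Qed.

Let theta6 : theta ^+ 6 = - (9 * a%:~R * theta ^+ m) - (9 * c%:~R - 1).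
Proof.
have /eqP := trinomial6_root f_root; rewrite -addrA addr_eq0 => /eqP->.
rewrite rmorphB !rmorphM /=; ring.
Qed.

Let rel_delta : order3_rel m a c theta delta.
Proof.
have e2 : u * delta = - (3 * delta) - u - 3 * c%:~R - 3 * a%:~R * theta ^+ m.
  (* Three times the left side is [u ^+ 3], obtained from [theta ^+ 6 - 1 = (u + 1) ^+ 3 - 1] and
     [theta6]. *)
  apply: (mulfI three0); transitivity (u * (3 * delta)); first by ring.
  rewrite -delta3.
  transitivity (- 3 * u ^+ 2 - 3 * u - 9 * c%:~R - 9 * a%:~R * theta ^+ m).
    transitivity (theta ^+ 6 - 1 - 3 * u ^+ 2 - 3 * u); first by rewrite /u; ring.
    by rewrite theta6; ring.
  by ring.
split=> //; apply: (mulfI three0).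
(* Here [3 * delta ^+ 2 = u ^+ 2 * delta], so multiplying [e2] by [u] gives the third relation. *)
rewrite -/u; transitivity (u * (u * delta)).
  by transitivity ((3 * delta) * delta); [ring | rewrite -delta3; ring].
transitivity (- (3 * (u * delta)) - u ^+ 2 - 3 * c%:~R * u - 3 * a%:~R * (u * theta ^+ m)).
  transitivity (u * (- (3 * delta) - u - 3 * c%:~R - 3 * a%:~R * theta ^+ m)).
    by rewrite -e2.
  by ring.
by rewrite delta3; ring.
Qed.

Let Odelta : ring_of_integers delta.
Proof.
have Ou : ring_of_integers u.
  by apply: integerB; [apply: integerX | apply: (integer_int _ 1)].
apply: (integer_quadratic (s := - u - 1)
  (t := - (c%:~R * u) - a%:~R * (u * theta ^+ m))).
- rewrite -opprD -sub0r; apply: integerB; first exact: (integer_int _ 0).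
  by apply: integerD => //; apply: (integer_int _ 1).
- rewrite -sub0r; apply: integerB; [apply: integerB; first exact: (integer_int _ 0)|];
    do ?[exact: integer_int | exact: Ou | exact: Otheta | apply: integerX | apply: integerM].
- by have [_ _ ->] := rel_delta; rewrite -/u; ring.
Qed.

Let indep (v : nat -> int) :
  \sum_(0 <= i < 6) (v i)%:~R * bieval theta delta (order3_basis i) = 0 ->
  forall i, (i < 6)%N -> v i = 0.
Proof.
rewrite /index_iota /= !big_cons big_nil /order3_basis /=.
rewrite !(rmorphM, rmorphB, rmorphXn, rmorph1) /= ?bievalX ?bievalY.
move=> v0.
(* The coefficients of the powers of [theta] in three times the given relation, with [3 * delta =
   theta ^+ 4 - 2 * theta ^+ 2 + 1]. *)
pose s : seq int := [:: 3 * v 0%N - 3 * v 2%N + v 4%N; 3 * v 1%N - 3 * v 3%N + v 5%N;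
  3 * v 2%N - 2 * v 4%N; 3 * v 3%N - 2 * v 5%N; v 4%N; v 5%N].
have s0 : forall i, s`_i = 0.
  apply: (small_degree_independent f_irr f_root); first by rewrite size_trinomial6.
  rewrite /index_iota /= !big_cons big_nil /=.
  rewrite !(rmorphB, rmorphD, rmorphM) /= -[RHS](mulr0 3) -[X in _ = 3 * X]v0.
  by rewrite /delta /u; field.
have := (s0 0%N, s0 1%N, s0 2%N, s0 3%N, s0 4%N, s0 5%N) => /=.
case=> [[[[[v0' v1'] v2'] v3'] v4'] v5'].
by case=> [|[|[|[|[|[|//]]]]]] _ //; lia.
Qed.

Let ev := bieval theta delta.

Let psi (t d : 'F_3) : {rmorphism {poly {poly int}} -> 'F_3} := bieval t d.

Let char3 : 3%N \in [pchar 'F_3].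
Proof. exact: pchar_Fp. Qed.

Let ker_psi t d : t ^+ 2 = 1 -> d ^+ 2 + d = 0 -> forall P, ev P = 0 -> psi t d P = 0.
Proof.
move=> t2 dE P P0.
apply: (bieval_ker rel_delta indep (order3_spanned a c m_le5 P) P0).
by apply: order3_rel_char3 => //; apply: (pcharf0 char3).
Qed.

Let psi_div3 t d P : t ^+ 2 = 1 -> d ^+ 2 + d = 0 -> ring_of_integers (ev P / 3) ->
  psi t d P = 0.
Proof. by move=> t2 dE; apply: residue_div_integer => //; apply: ker_psi. Qed.

(** The four residue maps kill [u], so they detect only the coordinates 0, 1, 4 and 5 modulo 3;
    coordinates 2 and 3 need a second integral element. *)
Let maximal_at_3 (x : K) : ring_of_integers x ->
  exists2 n, ~~ (3 %| n)%N & exists P, ev P = n%:R * x.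
Proof.
apply: maximal_at_prime => // [P OP|]; last exact: clear_denominators.
have [v vP] := order3_spanned a c m_le5 P.
have psi0 (t d : 'F_3) : t ^+ 2 = 1 -> d ^+ 2 + d = 0 ->
    ((v 0%N)%:~R + (v 1%N)%:~R * t) + ((v 4%N)%:~R + (v 5%N)%:~R * t) * d = 0.
  move=> t2 dE; rewrite -[RHS](psi_div3 t2 dE OP) /psi /= vP; last first.
    by apply: order3_rel_char3 => //; apply: (pcharf0 char3).
  rewrite /index_iota /= !big_cons big_nil /order3_basis /=.
rewrite !(rmorphM, rmorphB, rmorphXn, rmorph1) /= ?bievalX ?bievalY.
  by rewrite -expr2 t2; ring.
have dvd3 z : (z%:~R : 'F_3) = 0 -> (3 %| z)%Z by move/eqP; rewrite -(dvdz_pcharf char3).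
have F3 : 3 = 0 :> 'F_3 by apply: pcharf0 char3.
have one2 : (1 : 'F_3) ^+ 2 = 1 by rewrite expr1n.
have N1 : (-1 : 'F_3) ^+ 2 = 1 by rewrite sqrrN expr1n.
have d0 : (0 : 'F_3) ^+ 2 + 0 = 0 by rewrite expr0n addr0.
have d1 : (-1 : 'F_3) ^+ 2 + -1 = 0 by rewrite N1 subrr.
have split (x0 y0 : 'F_3) : x0 + y0 * 1 = 0 -> x0 + y0 * -1 = 0 -> x0 = 0 /\ y0 = 0.
  move=> e0 e1; split.
    by transitivity (3 * x0 - (x0 + y0 * 1 + (x0 + y0 * -1))); [ring|rewrite e0 e1 F3; ring].
  by transitivity (3 * y0 - (x0 + y0 * 1 - (x0 + y0 * -1))); [ring|rewrite e0 e1 F3; ring].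
have q t : t ^+ 2 = 1 -> (v 0%N)%:~R + (v 1%N)%:~R * t = 0 :> 'F_3 /\
    (v 4%N)%:~R + (v 5%N)%:~R * t = 0 :> 'F_3.
  move=> t2; have e0 := psi0 _ _ t2 d0; have e1 := psi0 _ _ t2 d1.
  move: e0; rewrite mulr0 addr0 => e0; split=> //; move: e1; rewrite e0 add0r mulrN1.
  by move/eqP; rewrite oppr_eq0 => /eqP.
have [q01 q23] := q _ one2; have [q01' q23'] := q _ N1.
have [v0 v1] := split _ _ q01 q01'; have [v4 v5] := split _ _ q23 q23'.
(* The residues leave [ev P / 3 - ev R = h * u / 3] with [h] linear in [theta];
   its square [h ^+ 2 * delta / 3] is integral, and the residues at [delta = -1]
   force [3] to divide [h]. *)
pose w i : int := if (i == 2)%N || (i == 3)%N then 0 else v i.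
have [|R RE] := @spanned_divisible 6 order3_basis K theta delta 3 w.
  by case=> [|[|[|[|[|[|//]]]]]] _; rewrite /w /=; apply: dvd3.
have evP : ev P = 3 * ev R + ((v 2%N)%:~R + (v 3%N)%:~R * theta) * u.
  rewrite -RE /ev vP; last exact: rel_delta.
  rewrite /index_iota /w /= !big_cons !big_nil /order3_basis /=.
rewrite !(rmorphM, rmorphB, rmorphXn, rmorph1) /= ?bievalX ?bievalY.
  by rewrite /u; ring.
pose S : {poly {poly int}} := ((v 2%N)%:~R + (v 3%N)%:~R * 'X%:P) ^+ 2 * 'X.
have evS : ev S / 3 = (ev P / 3 - ev R) ^+ 2.
  rewrite evP (_ : ev S = ((v 2%N)%:~R + (v 3%N)%:~R * theta) ^+ 2 * delta).
    by rewrite /delta; field.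
  by rewrite /ev /S rmorphM rmorphXn rmorphD rmorphM !rmorph_int /= bievalX bievalY.
have OR : ring_of_integers (ev P / 3 - ev R).
  by apply: integerB => //; apply: integer_bieval; [apply: Otheta | apply: Odelta].
have OS : ring_of_integers (ev S / 3) by rewrite evS; apply: integerX.
have psiS (t : 'F_3) : t ^+ 2 = 1 -> (v 2%N)%:~R + (v 3%N)%:~R * t = 0 :> 'F_3.
  move=> t2; have := psi_div3 t2 d1 OS.
  rewrite /psi /S /= rmorphM rmorphXn rmorphD rmorphM !rmorph_int /= bievalX bievalY mulrN1.
  by move/eqP; rewrite oppr_eq0 expf_eq0 => /eqP.
have [v2 v3] := split _ _ (psiS _ one2) (psiS _ N1).
have [|Q QE] := @spanned_divisible 6 order3_basis K theta delta 3 v.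
  by case=> [|[|[|[|[|[|//]]]]]] _; apply: dvd3.
by exists Q; rewrite -QE; apply: vP; apply: rel_delta.
Qed.

Lemma three_dvd_zindex alpha : ring_of_integers alpha ->
  (3 %| zindex (@ring_of_integers K) (Zadjoin alpha))%N.
Proof.
move=> Oalpha; apply: contraT => index_ndiv.
have [n n3 [P evP]] := maximal_at_3 Oalpha.
(* Pairs of booleans index the four residue maps: the first chooses [theta] as 1 or -1, the second
   [delta] as 0 or -1. *)
pose t (s : bool * bool) : 'F_3 := (-1) ^+ s.1.
pose d (s : bool * bool) : 'F_3 := - (s.2)%:R.
have t2 s : t s ^+ 2 = 1 by rewrite /t exprAC sqrrN expr1n expr1n.
have dE s : d s ^+ 2 + d s = 0.
  by rewrite /d; case: (s.2); rewrite ?sqrrN ?expr1n ?subrr // oppr0 expr0n addr0.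
have agree s s' Q : psi (t s) (d s) P = psi (t s') (d s') P -> ring_of_integers (ev Q) ->
    psi (t s) (d s) Q = psi (t s') (d s') Q.
  exact: (residues_agree char3 (ker_psi (t2 s) (dE s))
    (ker_psi (t2 s') (dE s')) index_ndiv n3 evP).
(* Maps equal at [P] agree at [theta] and [delta], which determine the pair; four distinct values do
   not fit in a field of three elements. *)
have inj : injective (fun s => psi (t s) (d s) P).
  move=> s s' e; have := agree _ _ 'X%:P e; have := agree _ _ 'X e.
  rewrite /ev /psi /= !bievalX !bievalY => /(_ Odelta) dd /(_ Otheta).
  by move: dd; case: s s' {e} => [[] []] [[] []].
by have := leq_card _ inj; rewrite card_prod card_bool card_Fp.
Qed.
End IndexAtThree.

(** * From single indices to the field index and monogenicity *)

Lemma field_index_dvd (K : fieldExtType rat) p :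
  (forall alpha : K, ring_of_integers alpha ->
     (p %| zindex (@ring_of_integers K) (Zadjoin alpha))%N) ->
  (p %| field_index K)%N.
Proof.
move=> pz; apply: (gcd_setP _).2 => _ [alpha [Oalpha _] <-]; exact: pz.
Qed.

(** A power basis makes [Zadjoin alpha] the whole ring of integers, which has one coset in
    itself. *)
Lemma monogenic_zindex (K : fieldExtType rat) : monogenic K ->
  exists2 alpha : K, ring_of_integers alpha &
    zindex (@ring_of_integers K) (Zadjoin alpha) = 1%N.
Proof.
move=> [alpha Oalpha [_ basis]]; exists alpha => //.
rewrite (_ : Zadjoin alpha = @ring_of_integers K).
  exact: zindex_id (integer_subgroup K).
rewrite predeqE => x; split=> [[q _ <-]|Ox].
  rewrite -(bievalC alpha 0); apply: integer_bieval => //; exact: (integer_int _ 0).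
have [v [-> _]] := basis x Ox.
exists (\sum_(i < \dim {:K}) v i *: 'X^i) => //.
rewrite rmorph_sum horner_sum; apply: eq_bigr => i _.
by rewrite /= map_polyZ map_polyXn hornerZ hornerXn mulrzl.
Qed.

Theorem theorem2p4 (m : nat) (a b : int) (K : fieldExtType rat) (theta : K)
  (hm : (m <= 5)%N)
  (hirr : irreducible_poly (map_poly (intr : int -> rat) (trinomial6 m a b)))
  (hroot : root (map_poly (intr : int -> K) (trinomial6 m a b)) theta)
  (hgen : is_generator theta) :
  [/\ (a = 0 %[mod 9])%Z /\ (b = -1 %[mod 9])%Z -> (3 %| field_index K)%N,
      (a = 0 %[mod 8])%Z /\ (b = -1 %[mod 4])%Z -> (2 %| field_index K)%N &
      ((a = 0 %[mod 9])%Z /\ (b = -1 %[mod 9])%Z) \/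
      ((a = 0 %[mod 8])%Z /\ (b = -1 %[mod 4])%Z) -> ~ monogenic K].
Proof.
(* Proved for each integral [alpha] rather than for the gcd, since it is also applied to the [alpha]
   of a power basis, whose index is 1. *)
have three : (a = 0 %[mod 9])%Z /\ (b = -1 %[mod 9])%Z ->
    forall alpha : K, ring_of_integers alpha ->
      (3 %| zindex (@ring_of_integers K) (Zadjoin alpha))%N.
  move=> [a9 b9]; have aE : a = 9 * (a %/ 9)%Z by lia.
  have bE : b = 9 * ((b + 1) %/ 9)%Z - 1 by lia.
  by rewrite aE bE in hirr hroot; apply: (three_dvd_zindex hm hirr hroot hgen).
have two : (a = 0 %[mod 8])%Z /\ (b = -1 %[mod 4])%Z ->
    forall alpha : K, ring_of_integers alpha ->
      (2 %| zindex (@ring_of_integers K) (Zadjoin alpha))%N.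
  move=> [a8 b4]; have aE : a = 8 * (a %/ 8)%Z by lia.
  have bE : b = 4 * ((b + 1) %/ 4)%Z - 1 by lia.
  by rewrite aE bE in hirr hroot; apply: (two_dvd_zindex hm hirr hroot hgen).
split=> [/three/field_index_dvd//|/two/field_index_dvd//|].
move=> cond /monogenic_zindex[alpha Oalpha index1].
by case: cond => [/three|/two] /(_ alpha Oalpha); rewrite index1.
Qed.
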